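(* Let $k\ge0$ be an integer, let $F\in\mathcal F_k(G)$, and let $\mathscr B^F$ be a $\mathbb Z$-basis of $B^1(G,F)$. In $\bigwedge^kC^1(G)$, the following identity holds: $$\det\mathscr B^F=\sum_{T\in\mathcal T(G),\,T\supseteq F}\det(\mathscr B^F/\mathscr B^F_T)\;e^\star_{T\setminus F}.$$
   Context: $G=(V,E)$ is a finite connected graph: $V$ is a finite set of vertices and $E$ a finite set of oriented edges, with source and target maps $s,t:E\to V$ and a fixed-point-free involution $e\mapsto e^{-1}$ of $E$ exchanging source and target. $E^+\subset E$ is a fixed subset containing exactly one element of each pair $\{e,e^{-1}\}$, with a fixed total order. A subgraph is a subset $S\subseteq E$ stable under $e\mapsto e^{-1}$, seen as the graph $(V,S)$; $S^+=S\cap E^+$, $S^c=E\setminus S$. $\mathcal T(G)$ is the set of spanning trees; $\mathcal F_k(G)$ is the set of acyclic (spanning) subgraphs with $k+1$ connected components. $C_1(G)$ is the free abelian group on $E$ modulo $e+e^{-1}=0$; $C^1(G)=\mathrm{Hom}(C_1(G),\mathbb Z)$, with basis $(e^\star)_{e\in E^+}$ dual to $E^+$; $C^1(S)$ is the subgroup generated by $\{e^\star:e\in S\}$. $\delta$ sends $f:V\to\mathbb Z$ to $\delta f\in C^1(G)$, $\delta f(e)=f(t(e))-f(s(e))$; $B^1(G)=\operatorname{im}\delta$; $B^1(G,F)=B^1(G)\cap C^1(F^c)$ is the group of coboundaries vanishing on $F$. For a spanning tree $T$ one has $C^1(G)=B^1(G)\oplus C^1(T^c)$, and $\mathsf B_T:C^1(G)\to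 B^1(G)$ is the corresponding projection. For $T\supseteq F$, $\mathscr B^F_T=(\mathsf B_T(e^\star):e\in(T\setminus F)^+)$, in the order of $E^+$, is a $\mathbb Z$-basis of $B^1(G,F)$. For a basis $\mathscr B=(u_1,\dots,u_k)$ of a free $\mathbb Z$-module, $\det\mathscr B=u_1\wedge\dots\wedge u_k$, and for two bases $\mathscr B_1,\mathscr B_2$ of the same module, $\det(\mathscr B_1/\mathscr B_2)=\pm1$ is the determinant of the matrix of $\mathscr B_1$ in $\mathscr B_2$. For $S\subseteq E$ with $S\cap E^+=\{e_1<\dots<e_r\}$, $e^\star_S=e_1^\star\wedge\dots\wedge e_r^\star$. *)

(* Defs.v *)
From HB Require Import structures.
From mathcomp Require Import all_boot all_order all_algebra ring_quotient.
From mathcomp Require Import boolp classical_sets functions.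
From mathcomp Require Import freeg.

Set Implicit Arguments.
Unset Strict Implicit.
Unset Printing Implicit Defensive.

Import GRing.Theory.

Local Open Scope ring_scope.
Local Open Scope quotient_scope.
Local Open Scope classical_set_scope.

Definition subgroup (M : zmodType) (B : set M) : Prop :=
  B 0 /\ forall x y, B x -> B y -> B (x - y).

Definition generated (M : zmodType) (A : set M) : set M :=
  smallest (@subgroup M) A.

Lemma generated_subgroup (M : zmodType) (A : set M) : subgroup (generated A).
Proof.
split=> [B [[B0 _] _]//|x y xA yA B BP].
by case: (BP) => -[_ BB] _; apply: BB; [exact: xA | exact: yA].
Qed.

Lemma sub_generated (M : zmodType) (A : set M) x : A x -> generated A x.
Proof. exact: sub_smallest. Qed.

Definition generatedb (M : zmodType) (A : set M) : pred M :=
  fun x => `[< generated A x >].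

Lemma generatedb_zmod_closed (M : zmodType) (A : set M) :
  zmod_closed (@generatedb M A).
Proof.
have [A0 AB] := generated_subgroup A.
by split=> [|x y /asboolP xA /asboolP yA]; apply/asboolP; [exact: A0 | exact: AB].
Qed.

HB.instance Definition _ (M : zmodType) (A : set M) :=
  GRing.isZmodClosed.Build M (@generatedb M A) (@generatedb_zmod_closed M A).

(* The abelian group generated by X subject to the relations r = 0, r in A. *)
Section Presented.
Variables (X : choiceType) (A : set {freeg X}).

Definition presented : Type :=
  Quotient.quot (GRing.ZmodClosed.clone {freeg X} (@generatedb {freeg X} A) _).
HB.instance Definition _ := EqQuotient.on presented.
HB.instance Definition _ := GRing.Zmodule.on presented.

Definition pres (D : {freeg X}) : presented :=
  \pi_(Quotient.quot (GRing.ZmodClosed.clone _ (@generatedb {freeg X} A) _)) D.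

Lemma presB : zmod_morphism pres.
Proof. by move=> D1 D2; rewrite /pres raddfB. Qed.
HB.instance Definition _ := GRing.isZmodMorphism.Build _ _ pres presB.

Lemma pres_eq0 (D : {freeg X}) : pres D = 0 <-> generated A D.
Proof.
rewrite -(raddf0 pres); split=> [/eqP|AD]; last apply/eqP.
  by rewrite -Quotient.idealrBE subr0 => /asboolP.
by rewrite -Quotient.idealrBE subr0; apply/asboolP.
Qed.

Lemma pres_surj (q : presented) : exists D, pres D = q.
Proof. by exists (repr q); exact: reprK. Qed.

Definition gen (x : X) : presented := pres << x >>.
End Presented.

(* Hom(U, W), a subgroup of the group of all functions U -> W. *)
Section Hom.
Variables U W : zmodType.

Definition additiveb : pred (U -> W) := fun f => `[< zmod_morphism f >].

Lemma additiveb_zmod_closed : zmod_closed additiveb.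
Proof.
split=> [|f g /asboolP fB /asboolP gB]; apply/asboolP=> x y.
  by rewrite subrr.
by rewrite !fctE fB gB !opprD addrACA.
Qed.
HB.instance Definition _ :=
  GRing.isZmodClosed.Build (U -> W) additiveb additiveb_zmod_closed.

Record hom := Hom { hom_fun :> U -> W; _ : additiveb hom_fun }.
HB.instance Definition _ := [isSub for hom_fun].
HB.instance Definition _ := [Choice of hom by <:].
HB.instance Definition _ := [SubChoice_isSubZmodule of hom by <:].

Lemma hom_zmod_morphism (f : hom) : zmod_morphism f.
Proof. by apply/asboolP; case: f. Qed.
HB.instance Definition _ (f : hom) :=
  GRing.isZmodMorphism.Build U W f (hom_zmod_morphism f).

Lemma homP (f g : hom) : f =1 g -> f = g.
Proof. by move=> fg; apply/val_inj/funext. Qed.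

Lemma hom_sumE I (r : seq I) (P : pred I) (f : I -> hom) u :
  (\sum_(i <- r | P i) f i) u = \sum_(i <- r | P i) f i u.
Proof. by elim/big_rec2: _ => // i y1 y2 _ <-. Qed.
End Hom.

(* The homomorphism out of a presented group extending g : X -> int. *)
Section Extend.
Variables (X : choiceType) (A : set {freeg X}) (g : X -> int).

Definition freeg_ev (D : {freeg X}) : int := fglift (g : X -> int^o) D.

Lemma freeg_evB : zmod_morphism freeg_ev.
Proof. exact: (lift_is_additive (g : X -> int^o)). Qed.
HB.instance Definition _ := GRing.isZmodMorphism.Build _ _ freeg_ev freeg_evB.

Lemma freeg_evU x : freeg_ev << x >> = g x.
Proof. by rewrite /freeg_ev liftU scale1r. Qed.

Definition extend_fun (q : presented A) : int := freeg_ev (repr q).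

Hypothesis gA : forall D, A D -> freeg_ev D = 0.

Lemma extend_fun_pres D : extend_fun (pres A D) = freeg_ev D.
Proof.
rewrite /extend_fun; apply/subr0_eq; rewrite -raddfB.
have : generated A (repr (pres A D) - D).
  apply/pres_eq0; rewrite raddfB /=; apply/eqP; rewrite subr_eq0; apply/eqP.
  exact: reprK.
move=> /(_ (fun D => freeg_ev D = 0)); apply; split=> //.
by split=> [|x y x0 y0]; rewrite ?raddf0// raddfB /= x0 y0 subrr.
Qed.

Lemma extend_fun_additive : additiveb extend_fun.
Proof.
apply/asboolP=> x y; have [D <-] := pres_surj x; have [D' <-] := pres_surj y.
by rewrite -raddfB !extend_fun_pres raddfB.
Qed.

Definition extend : hom (presented A) int := Hom extend_fun_additive.

Lemma extend_gen x : extend (gen A x) = g x.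
Proof. by rewrite /extend /= /gen extend_fun_pres freeg_evU. Qed.
End Extend.

Lemma hom_presentedP (X : choiceType) (A : set {freeg X}) (W : zmodType)
  (f g : hom (presented A) W) : (forall x, f (gen A x) = g (gen A x)) -> f = g.
Proof.
move=> fg; apply: homP => q; have [D <-] := pres_surj q.
rewrite -[D]freeg_sumE !raddf_sum; apply: eq_bigr => z _ /=.
rewrite -[coeff z D]intz -freegU_mulz !raddfMz.
by congr (_ *~ _); exact: fg.
Qed.

Section ExteriorPower.
Variables (M : zmodType) (k : nat).

(* Additivity in each argument, and vanishing when two arguments coincide;
   int-linearity follows from additivity. *)
Definition exterior_rel : set {freeg k.-tuple M} :=
  [set D | exists (i : 'I_k) (u v w : k.-tuple M),
     [/\ tnth u i = tnth v i + tnth w i,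
         forall j, j != i -> tnth v j = tnth u j /\ tnth w j = tnth u j
       & D = << u >> - << v >> - << w >>]] `|`
  [set D | exists (i j : 'I_k) (u : k.-tuple M),
     [/\ i != j, tnth u i = tnth u j & D = << u >>]].

Definition exterior : zmodType := presented exterior_rel.

Definition wedge (u : k.-tuple M) : exterior := gen exterior_rel u.

Lemma wedgeD (i : 'I_k) (u v w : k.-tuple M) :
  tnth u i = tnth v i + tnth w i ->
  (forall j, j != i -> tnth v j = tnth u j /\ tnth w j = tnth u j) ->
  wedge u = wedge v + wedge w.
Proof.
move=> uvw E; apply/eqP; rewrite -subr_eq0 opprD addrA; apply/eqP.
rewrite /wedge /gen -!raddfB; apply/pres_eq0; apply: sub_generated.
by left; exists i, u, v, w.
Qed.

Lemma wedge_alt (i j : 'I_k) (u : k.-tuple M) :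
  i != j -> tnth u i = tnth u j -> wedge u = 0.
Proof.
by move=> ij E; apply/pres_eq0; apply: sub_generated; right; exists i, j, u.
Qed.

End ExteriorPower.

Section Bases.
Variables (M : zmodType) (k : nat).
Implicit Types b : k.-tuple M.

Definition is_zbasis (N : set M) b : Prop :=
  generated [set x | x \in b] = N /\
  forall c : 'I_k -> int, \sum_i tnth b i *~ c i = 0 -> forall i, c i = 0.

(* The rows of A are the coordinates of b1 in b2.  Such an A is unique when b2
   is a basis, and exists when b1 is a basis of the same subgroup. *)
Definition is_matrix_in b1 b2 (A : 'M[int]_k) : Prop :=
  forall i, tnth b1 i = \sum_j tnth b2 j *~ A i j.

Definition det_bases b1 b2 : int := \det (xget 0 [set A | is_matrix_in b1 b2 A]).

(* Only used on sequences of size k, where it does not change the sequence. *)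
Definition to_tuple (s : seq M) : k.-tuple M := insubd (nseq_tuple k 0) s.

Lemma to_tupleK (s : seq M) : size s = k -> to_tuple s = s :> seq M.
Proof. by move=> sk; rewrite val_insubd sk eqxx. Qed.

End Bases.

(* einv_in_epos says that epos contains exactly one edge of each pair
   {e, einv e}; ele is a total order on epos. *)
Record graph := Graph {
  vertex : finType;
  edge : finType;
  src : edge -> vertex;
  tgt : edge -> vertex;
  einv : edge -> edge;
  einvK : involutive einv;
  einv_neq : forall e, einv e != e;
  src_einv : forall e, src (einv e) = tgt e;
  epos : {set edge};
  einv_in_epos : forall e, (einv e \in epos) = (e \notin epos);
  ele : rel edge;
  ele_anti : {in epos &, antisymmetric ele};
  ele_trans : {in epos & &, transitive ele};
  ele_total : {in epos &, total ele} }.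

Section Graph.
Variable G : graph.
Implicit Types (S T F : {set edge G}) (e : edge G).

Lemma tgt_einv e : tgt (einv e) = src e.
Proof. by rewrite -src_einv einvK. Qed.

Definition subgraph S : Prop := forall e, e \in S -> einv e \in S.

Definition adj S : rel (vertex G) :=
  [rel x y | [exists e in S, (src e == x) && (tgt e == y)]].

Definition nb_components S : nat := n_comp (adj S) predT.

Definition graph_connected : Prop := nb_components [set: edge G]%SET = 1%N.

(* Successive edges of a cycle, in the cyclic order, are composable and not
   inverse to each other; a loop is a cycle of length 1, and two distinct
   parallel edges form a cycle of length 2. *)
Definition is_cycle S (c : seq (edge G)) : Prop :=
  [/\ c != [::], {subset c <= S},
      cycle [rel e e' | (tgt e == src e') && (e' != einv e)] c
    & uniq (map (@src G) c)].

Definition acyclic S : Prop := forall c, ~ is_cycle S c.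

Definition forest (k : nat) S : Prop :=
  [/\ subgraph S, acyclic S & nb_components S = k.+1].

Definition spanning_tree S : Prop :=
  [/\ subgraph S, acyclic S & nb_components S = 1%N].

Definition chain_rel : set {freeg edge G} :=
  [set D | exists e, D = << e >> + << einv e >>].

Definition chain : zmodType := presented chain_rel.

Definition cochain : zmodType := hom chain int.

Section CochainOf.
Variables (g : edge G -> int) (gN : forall e, g (einv e) = - g e).

Lemma chain_rel_ev D : chain_rel D -> freeg_ev g D = 0.
Proof. by case=> e ->; rewrite raddfD /= !freeg_evU gN subrr. Qed.

Definition cochain_of : cochain := extend chain_rel_ev.

Lemma cochain_ofE e : cochain_of (gen chain_rel e) = g e.
Proof. exact: extend_gen. Qed.
End CochainOf.

Lemma cochainP (w w' : cochain) :
  (forall e, w (gen chain_rel e) = w' (gen chain_rel e)) -> w = w'.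
Proof. exact: hom_presentedP. Qed.

Lemma cochain_einv (w : cochain) e :
  w (gen chain_rel (einv e)) = - w (gen chain_rel e).
Proof.
apply/eqP; rewrite -addr_eq0 addrC -raddfD /gen -raddfD /=.
have -> : pres chain_rel (<< e >> + << einv e >>) = 0; last by rewrite raddf0.
by apply/pres_eq0; apply: sub_generated; exists e.
Qed.

Definition estar_fun e e' : int := (e' == e)%:R - (e' == einv e)%:R.

Lemma estar_funN e e' : estar_fun e (einv e') = - estar_fun e e'.
Proof.
by rewrite /estar_fun opprB (inv_eq (@einvK G)) (inj_eq (inv_inj (@einvK G))).
Qed.

(* For e in epos, the element dual to e; estar (einv e) = - estar e. *)
Definition estar e : cochain := cochain_of (estar_funN e).

Lemma delta_funN (f : vertex G -> int) e :
  f (tgt (einv e)) - f (src (einv e)) = - (f (tgt e) - f (src e)).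
Proof. by rewrite tgt_einv src_einv opprB. Qed.

Definition delta (f : vertex G -> int) : cochain :=
  cochain_of (g := fun e => f (tgt e) - f (src e)) (delta_funN f).

Definition coboundaries : set cochain := range delta.

Definition cochains_on S : set cochain :=
  generated [set w | exists2 e, e \in S & w = estar e].

Definition coboundaries_rel F : set cochain :=
  coboundaries `&` cochains_on (~: F)%SET.

(* The projection onto coboundaries along cochains_on (~: T), meaningful when
   these are complementary, as they are for T a spanning tree. *)
Definition tree_proj T (w : cochain) : cochain :=
  xget 0 [set b | coboundaries b /\ cochains_on (~: T)%SET (w - b)].

Definition pos_edges S : seq (edge G) := sort (@ele G) (enum (S :&: epos G)%SET).

Definition estar_tuple k S : k.-tuple cochain :=
  to_tuple k [seq estar e | e <- pos_edges S].

Definition tree_basis k T F : k.-tuple cochain :=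
  to_tuple k [seq tree_proj T (estar e) | e <- pos_edges (T :\: F)%SET].

End Graph.

(* Main.v *)
(* Write e' for the cochain dual to an edge e, and B_T for the projection onto
   coboundaries attached to a spanning tree T.  Expand each u_i in the basis of
   the e', e in E^+.  By multilinearity, wedge u is the sum over the k-subsets A
   of E^+ of det (u_i(e))_{e in A} times the wedge of the e', e in A.  Put
   T := F u A u A^-1.
   - If T is a spanning tree, then B_T(a')(b) = [a = b] for a, b in A, so that
     (u_i(e)) is the matrix of u in the basis of the B_T(e').
   - If A meets F, the matrix has a zero column.
   - If T is disconnected, the coboundary of the indicator of a component of T
     is a nonzero combination of the u_i vanishing on A: the rows are dependent.
   - If T contains a cycle, this cycle leaves F, and the vanishing of the u_i on
     cycles is a dependence relation between the columns. *)

From HB Require Import structures.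
From mathcomp Require Import fingroup perm.
Require Import Defs.
From mathcomp Require Import all_boot all_order all_algebra.
From mathcomp Require Import boolp.

Set Implicit Arguments.
Unset Strict Implicit.
Unset Printing Implicit Defensive.

Import GRing.Theory.
Local Open Scope ring_scope.

(** * Maps additive in each argument *)

Section Multiadditive.

Definition multiadditive (M W : zmodType) k (g : k.-tuple M -> W) : Prop :=
  forall (i : 'I_k) (u v w : k.-tuple M),
    tnth u i = tnth v i + tnth w i ->
    (forall j, j != i -> tnth v j = tnth u j /\ tnth w j = tnth u j) ->
    g u = g v + g w.

Lemma multiadditive_cons (M W : zmodType) k (g : k.+1.-tuple M -> W) x :
  multiadditive g -> multiadditive (fun t : k.-tuple M => g [tuple of x :: t]).
Proof.
move=> gD i u v w uvw E; apply: (gD (lift ord0 i)); first by rewrite !tnthS.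
by move=> j; case: (unliftP ord0 j) => [j' ->|-> _];
  rewrite ?tnthS ?tnth0 // => /E.
Qed.

(** With the tail fixed, [g] is additive in the head; packing it as an additive map gives
    compatibility with sums and integer multiples. *)
Lemma multiadditive_head_sum (M W : zmodType) k (g : k.+1.-tuple M -> W)
    (I : finType) (b : I -> M) (c : I -> int) (t : k.-tuple M) :
  multiadditive g ->
  g [tuple of (\sum_x b x *~ c x) :: t] = \sum_x g [tuple of b x :: t] *~ c x.
Proof.
move=> gD; pose h x := g [tuple of x :: t].
have hD x y : h (x + y) = h x + h y.
  apply: (gD ord0); first by rewrite !tnth0.
  by move=> j; case: (unliftP ord0 j) => [j' -> _|->]; rewrite ?eqxx // !tnthS.
have hB : zmod_morphism h.
  by move=> x y; apply/eqP; rewrite eq_sym subr_eq -hD subrK.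
pose hH := GRing.isZmodMorphism.Build M W h hB.
pose ha : {additive M -> W} := HB.pack h hH.
rewrite -[LHS]/(ha _) raddf_sum; apply: eq_bigr => x _.
by rewrite raddfMz.
Qed.

(** Induction on [k]: expand the head, then apply the induction hypothesis to the map of the tail
    obtained by freezing the head at each [b x]. *)
Lemma multiadditive_expand (M W : zmodType) k (g : k.-tuple M -> W)
    (I : finType) (b : I -> M) (c : 'I_k -> I -> int) :
  multiadditive g ->
  g [tuple \sum_x b x *~ c i x | i < k] =
    \sum_(phi : k.-tuple I) g (map_tuple b phi) *~ \prod_i c i (tnth phi i).
Proof.
elim: k g c => [|k IHk] g c gD.
  rewrite (big_pred1 [tuple]) => [|phi]; last by apply/esym/eqP; exact: tuple0.
  by rewrite big_ord0 mulr1z; congr g; rewrite [LHS]tuple0 [RHS]tuple0.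
pose f (p : I * k.-tuple I) := [tuple of p.1 :: p.2].
rewrite (reindex f) /=; last first.
  exists (fun t : k.+1.-tuple I => (thead t, [tuple of behead t])).
    by move=> [x t] _; rewrite /f /= theadE; congr (_, _); apply: val_inj.
  by move=> t _; rewrite /f /= -tuple_eta.
rewrite -(pair_bigA _ (fun x (t : k.-tuple I) =>
  g (map_tuple b (f (x, t))) *~ \prod_i c i (tnth (f (x, t)) i))) /=.
have -> : [tuple \sum_x b x *~ c i x | i < k.+1] =
  [tuple of (\sum_x b x *~ c ord0 x) ::
     [tuple \sum_x b x *~ c (lift ord0 i) x | i < k]].
  apply: eq_from_tnth => j; rewrite tnth_mktuple.
  by case: (unliftP ord0 j) => [j' ->|->]; rewrite ?tnth0 // tnthS tnth_mktuple.
rewrite multiadditive_head_sum //; apply: eq_bigr => x _.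
rewrite (IHk _ (fun i => c (lift ord0 i)) (multiadditive_cons (b x) gD)).
rewrite mulrz_suml; apply: eq_bigr => t _.
rewrite -mulrzA big_ord_recl /= tnth0 mulrC; congr (g _ *~ (_ * _)).
  exact: val_inj.
by apply: eq_bigr => i _; rewrite tnthS.
Qed.

End Multiadditive.

(** * Antisymmetry and expansion of wedge products *)

Section Wedge.
Variables (M : zmodType) (k : nat).
Implicit Types (v : k.-tuple M).

Lemma wedge_multiadditive : multiadditive (@wedge M k).
Proof. exact: wedgeD. Qed.

(** Polarization: the wedge with the sum of the two entries in both slots [i] and [j] vanishes, and
    so do its two diagonal terms; the two cross terms are therefore opposite. *)
Lemma wedge_tperm v (i j : 'I_k) : i != j ->
  wedge [tuple tnth v (tperm i j l) | l < k] = - wedge v.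
Proof.
move=> ij; have ji : j != i by rewrite eq_sym.
pose f a b :=
  [tuple if l == i then a else if l == j then b else tnth v l | l < k].
have fDl a a' b : wedge (f (a + a') b) = wedge (f a b) + wedge (f a' b).
  apply: (@wedgeD _ _ i); first by rewrite !tnth_mktuple eqxx.
  by move=> l /negPf li; rewrite !tnth_mktuple li.
have fDr a b b' : wedge (f a (b + b')) = wedge (f a b) + wedge (f a b').
  apply: (@wedgeD _ _ j); first by rewrite !tnth_mktuple (negPf ji) eqxx.
  by move=> l /negPf lj; rewrite !tnth_mktuple lj.
have f0 a : wedge (f a a) = 0.
  by apply: (wedge_alt ij); rewrite !tnth_mktuple !eqxx; case: ifP.
have := f0 (tnth v i + tnth v j); rewrite fDl !fDr !f0 add0r addr0.
move/eqP; rewrite addrC addr_eq0 => /eqP E.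
have -> : [tuple tnth v (tperm i j l) | l < k] = f (tnth v j) (tnth v i).
  apply: eq_from_tnth => l; rewrite !tnth_mktuple.
  by case: tpermP => [->|->|/eqP/negPf -> /eqP/negPf -> //];
     rewrite ?eqxx // (negPf ji).
rewrite E; congr (- wedge _); apply: eq_from_tnth => l; rewrite tnth_mktuple.
by case: eqP => [->//|_]; case: eqP => [->|].
Qed.

Lemma wedge_perm v (s : 'S_k) :
  wedge [tuple tnth v (s l) | l < k] = wedge v *~ (-1) ^+ s.
Proof.
case: (prod_tpermP s) => ts -> {s}; elim: ts v => [|t ts IHts] v /=.
  move=> _; rewrite big_nil odd_perm1 expr0 mulr1z; congr wedge.
  by apply: eq_from_tnth => l; rewrite tnth_mktuple perm1.
case/andP=> t12 /[dup] ts_dp /IHts {}IHts; rewrite big_cons.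
set s := (\prod_(_ <- _) _)%g in IHts *.
have -> : [tuple tnth v ((tperm t.1 t.2 * s)%g l) | l < k] =
  [tuple tnth [tuple tnth v (s l) | l < k] (tperm t.1 t.2 l) | l < k].
  by apply: eq_from_tnth => l; rewrite !tnth_mktuple permM.
rewrite wedge_tperm // IHts odd_mul_tperm t12 /=.
by case: (odd_perm s); rewrite /= ?expr0 ?expr1 !mulrNz ?opprK.
Qed.

Lemma wedge_map_nuniq (I : eqType) (b : I -> M) (phi : k.-tuple I) :
  ~~ uniq phi -> wedge (map_tuple b phi) = 0.
Proof.
move=> phiN; have /injectivePn[i [j ij E]] : ~~ injectiveb (tnth phi).
  by apply: contra phiN => /injectiveP/tuple_uniqP.
by apply: (wedge_alt ij); rewrite !tnth_map E.
Qed.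

(** Index tuples with a repetition contribute 0. The others are grouped by their set [A] of entries;
    within a group they are the rearrangements of [r A], one for each permutation, and the signs
    assemble the Leibniz formula. The ordering [r] is left free so that it can be taken to be that
    of the positive edges. *)
Lemma wedge_expand (I : finType) (r : {set I} -> seq I) (b : I -> M)
    (c : 'I_k -> I -> int) :
  (forall A, perm_eq (r A) (enum A)) ->
  wedge [tuple \sum_x b x *~ c i x | i < k] =
    \sum_(A : {set I} | #|A| == k)
      wedge (to_tuple k [seq b x | x <- r A]) *~
        \det (\matrix_(i, j) nth 0 [seq c i x | x <- r A] j).
Proof.
move=> rE; rewrite (multiadditive_expand _ _ wedge_multiadditive).
rewrite (bigID (fun phi : k.-tuple I => uniq phi)) /= addrC big1 ?add0r;
  last first.
  by move=> phi /wedge_map_nuniq ->; rewrite mul0rz.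
rewrite (partition_big (fun phi : k.-tuple I => [set x in phi])
  (fun A : {set I} => #|A| == k)) /=; last first.
  by move=> phi phiU; rewrite cardsE (card_uniqP phiU) size_tuple.
apply: eq_bigr => A /eqP Ak.
have rk : size (r A) == k by rewrite (perm_size (rE A)) -cardE Ak.
have rU : uniq (r A) by rewrite (perm_uniq (rE A)) enum_uniq.
pose a : k.-tuple I := Tuple rk.
pose h (s : 'S_k) : k.-tuple I := [tuple tnth a (s l) | l < k].
have hI : injective h.
  move=> s s' /(congr1 (fun t => tnth t)) E; apply/perm.permP => l.
  have := congr1 (@^~ l) E; rewrite !tnth_mktuple.
  by apply: (tuple_uniqP a rU).
rewrite (eq_bigl (fun phi => phi \in [set h s | s in setT])); last first.
  move=> phi; apply/andP/imsetP => [[phiU /eqP phiA]|[s _ ->]].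
    have : perm_eq phi a.
      rewrite uniq_perm // => x; rewrite (perm_mem (rE A)) mem_enum -phiA.
      by rewrite inE.
    by case/tuple_permP => s sE; exists s => //; exact: val_inj.
  have ps : perm_eq (h s) a by apply/tuple_permP; exists s.
  split; first by rewrite (perm_uniq ps).
  by apply/eqP/setP => x; rewrite inE (perm_mem ps) (perm_mem (rE A)) mem_enum.
rewrite big_imset /=; last by move=> ? ? _ _; exact: hI.
have -> : to_tuple k [seq b x | x <- r A] = map_tuple b a.
  by apply: val_inj; rewrite /= to_tupleK // size_map (eqP rk).
rewrite /determinant mulrz_sumr; apply: eq_big => [s|s _]; first by rewrite inE.
have -> : map_tuple b (h s) = [tuple tnth (map_tuple b a) (s l) | l < k].
  by apply: eq_from_tnth => l; rewrite tnth_map !tnth_mktuple tnth_map.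
rewrite wedge_perm -mulrzA; congr (_ *~ (_ * _)); apply: eq_bigr => i _.
rewrite tnth_mktuple mxE (nth_map (tnth a i)) ?(eqP rk) //.
by rewrite (tnth_nth (tnth a i)).
Qed.

End Wedge.

(** * Integer combinations and vanishing determinants *)

Lemma generated_sumMz (M : zmodType) (A : classical_sets.set M) (I : finType)
    (x : I -> M) (c : I -> int) :
  (forall i, c i != 0 -> A (x i)) -> generated A (\sum_i x i *~ c i).
Proof.
move=> xA.
suff: (\sum_i x i *~ c i) \in generatedb A by move/asboolP.
apply: rpred_sum => i _; case: (eqVneq (c i) 0) => [->|ci].
  by rewrite mulr0z rpred0.
by apply: rpredMz; apply/asboolP; apply: sub_generated; exact: xA.
Qed.

Lemma generated_tuple (M : zmodType) k (u : k.-tuple M) x :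
  generated (classical_sets.mkset (fun y => y \in u)) x ->
  exists c : 'I_k -> int, x = \sum_i tnth u i *~ c i.
Proof.
move/(_ (fun x => exists c : 'I_k -> int, x = \sum_i tnth u i *~ c i)); apply.
split=> [|y /tnthP[i ->]]; last first.
  exists (fun j => (j == i)%:R).
  rewrite (bigD1 i) //= eqxx mulr1z big1 ?addr0 //.
  by move=> j /negPf ->; rewrite mulr0z.
split=> [|y z [c ->] [d ->]].
  by exists (fun=> 0); rewrite big1 // => i _; rewrite mulr0z.
exists (fun i => c i - d i); rewrite -sumrB; apply: eq_bigr => i _.
by rewrite mulrzBr.
Qed.

(** The vector [m] is a nonzero element of the kernel; the transpose turns it into the row vector
    expected by [det0P]. *)
Lemma det0_col (R : idomainType) k (M : 'M[R]_k) (m : 'I_k -> R) j :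
  m j != 0 -> (forall i, \sum_l M i l * m l = 0) -> \det M = 0.
Proof.
move=> mj Mm; rewrite -det_tr; apply/eqP/det0P; exists (\row_l m l).
  by apply: contraNneq mj => /rowP/(_ j); rewrite !mxE => ->.
apply/rowP => i; rewrite !mxE -[RHS](Mm i).
by apply: eq_bigr => l _; rewrite !mxE mulrC.
Qed.

Lemma det0_row (R : idomainType) k (M : 'M[R]_k) (m : 'I_k -> R) i :
  m i != 0 -> (forall j, \sum_l m l * M l j = 0) -> \det M = 0.
Proof.
move=> mi Mm; rewrite -det_tr; apply: (det0_col mi) => j; rewrite -[RHS](Mm j).
by apply: eq_bigr => l _; rewrite !mxE mulrC.
Qed.

(** * Cochains and coboundaries through their values on edges *)

Section Cochains.
Variable G : graph.
Implicit Types (S T F : {set edge G}) (e : edge G) (w : cochain G).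

Definition value e w : int := w (gen (@chain_rel G) e).
Arguments value : simpl never.

Lemma value_zmod_morphism e : zmod_morphism (value e).
Proof. by move=> w w'; rewrite /value. Qed.
HB.instance Definition _ e :=
  GRing.isZmodMorphism.Build (cochain G) int (value e) (value_zmod_morphism e).

Lemma valueB w w' e : value e (w - w') = value e w - value e w'.
Proof. exact: (raddfB (value e)). Qed.

Lemma value_sum (I : finType) (v : I -> cochain G) (c : I -> int) e :
  value e (\sum_i v i *~ c i) = \sum_i value e (v i) * c i.
Proof.
rewrite (raddf_sum (value e)); apply: eq_bigr => i _.
by rewrite (raddfMz (value e)) mulrzz.
Qed.

Lemma value_inj w w' : (forall e, value e w = value e w') -> w = w'.
Proof. exact: cochainP. Qed.

Lemma valueN w e : value (einv e) w = - value e w.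
Proof. exact: cochain_einv. Qed.

Lemma value_estar e e' : value e' (estar e) = (e' == e)%:R - (e' == einv e)%:R.
Proof. exact: cochain_ofE. Qed.

Lemma value_delta f e : value e (delta f) = f (tgt e) - f (src e).
Proof. exact: cochain_ofE. Qed.

Lemma value_estar_pos e e' : e \in epos G -> e' \in epos G ->
  value e' (estar e) = (e' == e)%:R.
Proof.
move=> eP e'P; rewrite value_estar; case: (eqVneq e' (einv e)) => [E|_].
  by move: e'P; rewrite E einv_in_epos eP.
by rewrite subr0.
Qed.

(** Both sides agree on positive edges by duality, hence everywhere since both change sign under
    [einv]. The sum runs over all edges, with coefficient 0 off [epos G], so that its index type is
    a finite type. *)
Lemma estar_expansion w :
  w = \sum_e estar e *~ (if e \in epos G then value e w else 0).
Proof.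
have main e : e \in epos G -> value e w =
    value e (\sum_e' estar e' *~ (if e' \in epos G then value e' w else 0)).
  move=> eP; rewrite value_sum (bigD1 e) //= eP value_estar_pos // eqxx mul1r.
  rewrite big1 ?addr0 // => e' e'e; case: ifP => [e'P|]; last by rewrite mulr0.
  by rewrite value_estar_pos // eq_sym (negPf e'e) mul0r.
apply: value_inj => e; case: (boolP (e \in epos G)) => [/main//|eN].
rewrite -[e](@einvK G) [LHS]valueN [RHS]valueN; congr (- _).
by apply: main; rewrite einv_in_epos.
Qed.

Lemma cochains_onP S w : subgraph S ->
  cochains_on S w <-> (forall e, e \notin S -> value e w = 0).
Proof.
move=> Sinv; split.
  move/(_ (fun w => forall e, e \notin S -> value e w = 0)); apply; split.
    split=> [e _|x y x0 y0 e eS]; first exact: (raddf0 (value e)).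
    by rewrite valueB x0 ?y0 ?subrr.
  move=> x [e' e'S ->] e eS; rewrite value_estar.
  case: eqVneq => [E|_]; first by rewrite -E (negPf eS) in e'S.
  case: eqVneq => [E|_]; last by rewrite subrr.
  by rewrite E (Sinv _ e'S) in eS.
move=> w0; rewrite [w]estar_expansion; apply: generated_sumMz => e.
case: ifP => [eP we|]; last by rewrite eqxx.
by exists e => //; apply: contraNT we => /w0 ->.
Qed.

Lemma subgraphC S : subgraph S -> subgraph (~: S).
Proof.
by move=> Sinv e; rewrite !inE; apply: contra => /Sinv; rewrite einvK.
Qed.

Lemma coboundaries_relP F w : subgraph F ->
  coboundaries_rel F w <->
  coboundaries w /\ (forall e, e \in F -> value e w = 0).
Proof.
move=> Finv; have := cochains_onP w (subgraphC Finv).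
split=> -[wB wF]; split=> //.
  by move=> e eF; apply: (H.1 wF); rewrite inE eF.
by apply: H.2 => e; rewrite inE negbK => /wF.
Qed.

Lemma coboundariesB w w' :
  coboundaries w -> coboundaries w' -> coboundaries (w - w').
Proof.
move=> [f _ <-] [f' _ <-]; exists (fun x => f x - f' x) => //.
apply: value_inj => e; rewrite valueB !value_delta.
by rewrite !opprD !opprK addrACA.
Qed.

Lemma coboundaries_sumMz (I : finType) (v : I -> cochain G) (c : I -> int) :
  (forall i, coboundaries (v i)) -> coboundaries (\sum_i v i *~ c i).
Proof.
move=> vB; have := @generated_sumMz _ (@coboundaries G) I v c (fun i _ => vB i).
move/(_ (@coboundaries G)); apply; split=> //; split; last exact: coboundariesB.
exists (fun=> 0) => //; apply: value_inj => e.
by rewrite value_delta subrr (raddf0 (value e)).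
Qed.

(** * Connectivity of subgraphs *)

Lemma adj_sym S : subgraph S -> symmetric (adj S).
Proof.
move=> Sinv; suff H x y : adj S x y -> adj S y x.
  by move=> x y; apply/idP/idP; exact: H.
case/exists_inP => e eS /andP[/eqP <- /eqP <-].
by apply/exists_inP; exists (einv e); rewrite ?Sinv // src_einv tgt_einv !eqxx.
Qed.

Lemma adj_edge S e : e \in S -> adj S (src e) (tgt e).
Proof. by move=> eS; apply/exists_inP; exists e => //; rewrite !eqxx. Qed.

Lemma nb_components1_connect S x y :
  subgraph S -> nb_components S = 1%N -> connect (adj S) x y.
Proof.
move=> Sinv /eqP; have symS := sym_connect_sym (adj_sym Sinv).
rewrite /nb_components /n_comp_mem (eq_card (fun _ => andbT _)) => /eqP S1.
have /card_le1_eqP rootsI : (#|roots (adj S)| <= 1)%N by rewrite S1.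
by rewrite -(root_connect symS); apply/eqP/rootsI; exact: roots_root.
Qed.

(** The vertex [x] excludes the empty graph, which has no component. *)
Lemma connect_nb_components1 S (x : vertex G) :
  subgraph S -> (forall y z, connect (adj S) y z) -> nb_components S = 1%N.
Proof.
move=> Sinv Sc; have symS := sym_connect_sym (adj_sym Sinv).
rewrite -(n_comp_connect symS x); apply: eq_n_comp_r => y.
by rewrite !inE Sc.
Qed.

Lemma connected_vertex : graph_connected G -> inhabited (vertex G).
Proof.
move=> /eqP; rewrite eqn_leq => /andP[_].
by rewrite /nb_components /n_comp_mem => /card_gt0P[x _]; exact: (inhabits x).
Qed.

(** A potential of [w] takes the same value at both ends of each edge of [S], hence is constant on
    the connected graph. *)
Lemma coboundary_eq0 S w : coboundaries w ->
  (forall x y, connect (adj S) x y) -> (forall e, e \in S -> value e w = 0) ->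
  w = 0.
Proof.
move=> [f _ <-] Sc S0; apply: value_inj => e.
rewrite value_delta [RHS](raddf0 (value e)).
apply/eqP; rewrite subr_eq0; apply/eqP.
suff: closed (adj S) [pred x | f x == f (src e)].
  move/closed_connect/(_ _ _ (Sc (src e) (tgt e))).
  by rewrite !inE eqxx => /esym/eqP.
move=> x y /exists_inP[e' /S0]; rewrite value_delta => /subr0_eq E.
by case/andP=> /eqP <- /eqP <-; rewrite !inE E.
Qed.

(** * Bridges of forests and the projection attached to a tree *)

Definition follows : rel (edge G) :=
  [rel e e' | (tgt e == src e') && (e' != einv e)].

(** Choosing an edge for each step gives no backtracking, since reversing an edge would return to a
    vertex already visited. The edge [e0] is the one travelled just before; the last hypothesis
    keeps the first step from reversing it. *)
Lemma lift_simple_path S e0 x (p : seq (vertex G)) :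
  path (adj S) x p -> uniq (x :: p) -> tgt e0 = x ->
  (einv e0 \notin S) || (src e0 \notin p) ->
  exists q, [/\ {subset q <= S}, path follows e0 q, map (@src G) q = belast x p
    & tgt (last e0 q) = last x p].
Proof.
elim: p x e0 => [|y p IHp] x e0 /=; first by exists [::].
case/andP=> /exists_inP[e1 e1S /andP[/eqP e1x /eqP e1y]] yp /andP[].
rewrite inE negb_or => /andP[xy xp] U e0x H.
have [|q [qS qp qs qt]] := IHp y e1 yp U e1y.
  by rewrite e1x xp orbT.
exists (e1 :: q); split => //=.
- by move=> e; rewrite inE => /predU1P[->|/qS].
- rewrite qp andbT /follows /= e0x e1x eqxx /=; apply: contraTneq H => E.
  rewrite -E e1S /= negbK -[e0](@einvK G) src_einv -E e1y.
  exact: mem_head.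
- by rewrite e1x qs.
Qed.

Lemma subgraph_delete T e :
  subgraph T -> subgraph (T :\: [set e; einv e]).
Proof.
move=> Tinv e'; rewrite !inE !negb_or => /andP[/andP[e'e e'Ve] /Tinv ->].
by rewrite andbT (inj_eq (inv_inj (@einvK G))) e'e andbT (inv_eq (@einvK G)).
Qed.

(** A simple path from [tgt e] back to [src e] in the rest of [T], lifted to edges, would form a
    cycle with [e]. *)
Lemma acyclic_bridge T e : subgraph T -> acyclic T -> e \in T ->
  ~~ connect (adj (T :\: [set e; einv e])) (tgt e) (src e).
Proof.
move=> Tinv Tac eT; set S := _ :\: _.
have Sinv : subgraph S by exact: subgraph_delete.
have eS : e \notin S by rewrite !inE eqxx.
have VeS : einv e \notin S by rewrite !inE eqxx orbT.
apply/negP => /connectP[p0 p0p]; case/shortenP: p0p => p pp pU _ pe.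
have [|q [qS qp qs qt]] := lift_simple_path pp pU erefl; first by rewrite VeS.
apply: (Tac (e :: q)); split=> //=.
- by move=> e'; rewrite inE => /predU1P[->//|/qS]; rewrite inE => /andP[].
- rewrite rcons_path -/follows qp /follows /= qt -pe eqxx /=.
  (* The closing step must not reverse the last edge. If [q] is empty, [e] is a loop and differs
     from its inverse; otherwise the last edge lies in [S], which is stable under inversion and
     avoids [e]. *)
  case: (lastP q) qS => [_|q' e' /(_ e')]; first by rewrite /= eq_sym einv_neq.
  rewrite mem_rcons mem_head last_rcons => /(_ isT)/Sinv.
  by apply: contraTneq => <-.
- by move: pU; rewrite lastI -pe rcons_uniq qs.
Qed.

(** Induction on the number of edges: remove an edge and its inverse, take a potential for the rest,
    then correct it on one side of the bridge. *)
Lemma acyclic_potential T w : subgraph T -> acyclic T ->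
  exists f : vertex G -> int,
    forall e, e \in T -> value e (delta f) = value e w.
Proof.
have [n] := ubnP #|T|; elim: n T => // n IHn T Tn Tinv Tac.
have [->|[e eT]] := set_0Vmem T; first by exists (fun=> 0) => e; rewrite inE.
have := acyclic_bridge Tinv Tac eT; set S := T :\: _ => br.
have ST : S \subset T by exact: subsetDl.
have Sinv : subgraph S by exact: subgraph_delete.
have [||f fS] := IHn S _ Sinv.
- rewrite -ltnS; apply: leq_trans Tn; rewrite ltnS; apply: proper_card.
  by rewrite properE ST; apply/subsetPn; exists e; rewrite // !inE eqxx.
- by move=> c [c0 cS cc cU]; apply: (Tac c); split=> // x /cS/(subsetP ST).
pose d := value e w - value e (delta f).
(* The defect [d] at [e] is added on the component of [tgt e] in [S]. It does not reach [src e],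
   because [e] is a bridge, and it cancels on each edge of [S]. *)
exists (fun x => f x + (if connect (adj S) (tgt e) x then d else 0)) => e' e'T.
set g := delta _.
have ge : value e g = value e w.
  rewrite value_delta connect0 (negPf br) addr0.
  by rewrite addrAC -value_delta addrC subrK.
have [->//|e'e] := eqVneq e' e; have [->|e'Ve] := eqVneq e' (einv e).
  by rewrite !valueN ge.
have e'S : e' \in S by rewrite !inE negb_or e'e e'Ve.
have symS := sym_connect_sym (adj_sym Sinv).
rewrite -fS // !value_delta (same_connect_r symS (connect1 (adj_edge e'S))).
by rewrite opprD addrACA subrr addr0.
Qed.

(** A potential for [w] on [T] provides the decomposition, so the choice in [tree_proj] does not
    fall back on its default value 0. *)
Lemma tree_projP T w : spanning_tree T ->
  coboundaries (tree_proj T w) /\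
  forall e, e \in T -> value e (tree_proj T w) = value e w.
Proof.
move=> [Tinv Tac _]; have [f fw] := acyclic_potential w Tinv Tac.
have /(classical_sets.xgetPex 0) : exists b,
    coboundaries b /\ cochains_on (~: T)%SET (w - b).
  exists (delta f); split; first by exists f.
  apply/(cochains_onP _ (subgraphC Tinv)) => e; rewrite inE negbK => eT.
  by rewrite valueB fw // subrr.
rewrite -/(tree_proj T w) => -[bB /(cochains_onP _ (subgraphC Tinv)) b0].
split=> // e eT; apply/esym/subr0_eq; rewrite -valueB b0 // inE negbK //.
Qed.

(** * Coboundaries along cycles *)

Lemma cycle_tgt_src S c : is_cycle S c ->
  perm_eq (map (@tgt G) c) (map (@src G) c).
Proof.
case=> _ _ cc _; case: c cc => // e q.
have H x p : path follows x p -> map (@tgt G) (belast x p) = map (@src G) p.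
  by elim: p x => //= y p IHp x /andP[/andP[/eqP -> _] /IHp ->].
by move/H; rewrite belast_rcons => ->; rewrite map_rcons /= perm_rcons.
Qed.

Lemma cycle_sum0 S c w : is_cycle S c -> coboundaries w ->
  \sum_(e <- c) value e w = 0.
Proof.
move=> cS [f _ <-]; under eq_bigr do rewrite value_delta.
rewrite sumrB; apply/eqP; rewrite subr_eq0; apply/eqP.
rewrite -(big_map (@tgt G) xpredT f) -(big_map (@src G) xpredT f).
exact/perm_big/(cycle_tgt_src cS).
Qed.

(** The successor of [e] in the cycle starts at [tgt e], as does [einv e]. Sources being distinct,
    the two would coincide, which is a forbidden backtracking. *)
Lemma cycle_einv S c e : is_cycle S c -> e \in c -> einv e \notin c.
Proof.
case=> _ _ cc cU ec; apply/negP => Vec.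
have /andP[/eqP tn] := next_cycle cc ec; case/negP.
have srcI (s : seq (edge G)) :
    uniq (map (@src G) s) -> {in s &, injective (@src G)}.
  elim: s => // x s IHs /= /andP[xs sU] y z; rewrite !inE.
  case/predU1P=> [->|ys] /predU1P[->//|zs] E.
  - by rewrite E map_f in xs.
  - by rewrite -E map_f in xs.
  - exact: IHs.
by apply/eqP/(srcI c) => //; rewrite ?mem_next // -tn src_einv.
Qed.

Lemma mem_pos_edges S e : (e \in pos_edges S) = (e \in S) && (e \in epos G).
Proof. by rewrite mem_sort mem_enum inE. Qed.

Lemma pos_edges_uniq S : uniq (pos_edges S).
Proof. by rewrite sort_uniq enum_uniq. Qed.

Lemma mem_pos_edges_tnth S n (a : n.-tuple (edge G)) j :
  a = pos_edges S :> seq _ -> (tnth a j \in S) && (tnth a j \in epos G).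
Proof. by move=> aE; rewrite -mem_pos_edges -aE mem_tnth. Qed.

(** * The basis of relative coboundaries given by a tree *)

Section TreeBasis.
Variables (T F : {set edge G}) (n : nat) (a : n.-tuple (edge G)).
Hypotheses (Ttree : spanning_tree T) (FT : F \subset T) (Finv : subgraph F).
Hypothesis aE : a = pos_edges (T :\: F) :> seq _.

Let t j := tree_proj T (estar (tnth a j)).

Lemma tree_proj_dual i j : value (tnth a i) (t j) = (i == j)%:R.
Proof.
have /andP[+ aiP] := mem_pos_edges_tnth i aE.
have /andP[_ ajP] := mem_pos_edges_tnth j aE.
rewrite inE => /andP[_ aiT].
rewrite (tree_projP _ Ttree).2 // value_estar_pos //.
have aU : uniq a by rewrite aE pos_edges_uniq.
by rewrite (inj_eq (elimT (tuple_uniqP a) aU)).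
Qed.

Lemma tree_proj_rel j : coboundaries_rel F (t j).
Proof.
have /andP[+ _] := mem_pos_edges_tnth j aE; rewrite inE => /andP[ajF _].
apply/coboundaries_relP => //; split=> [|e eF].
  exact: (tree_projP _ Ttree).1.
rewrite (tree_projP _ Ttree).2 ?(subsetP FT) // value_estar.
case: eqVneq => [E|_]; first by rewrite -E eF in ajF.
case: eqVneq => [E|_]; last by rewrite subrr.
by move: (Finv eF); rewrite E einvK (negPf ajF).
Qed.

(** Both sides are coboundaries that agree on [T]: on [F] both vanish, and on the edges of [a]
    duality applies. Since [T] connects all vertices, their difference is 0. *)
Lemma tree_proj_expansion w : coboundaries_rel F w ->
  w = \sum_j t j *~ value (tnth a j) w.
Proof.
move=> /coboundaries_relP-/(_ Finv)[wB wF].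
have sB : coboundaries (\sum_j t j *~ value (tnth a j) w).
  by apply: coboundaries_sumMz => j; exact: (tree_projP _ Ttree).1.
have sF e : e \in F -> value e (\sum_j t j *~ value (tnth a j) w) = 0.
  move=> eF; rewrite value_sum big1 // => j _.
  by have /coboundaries_relP-/(_ Finv)[_ ->] := tree_proj_rel j; rewrite ?mul0r.
have [Tinv _ T1] := Ttree.
apply/subr0_eq; apply: (coboundary_eq0 (coboundariesB wB sB)).
  by move=> x y; exact: (nb_components1_connect x y Tinv T1).
move=> e eT; rewrite valueB; case: (boolP (e \in F)) => [eF|eF].
  by rewrite wF // sF // subrr.
have pos e' : e' \in T -> e' \notin F -> e' \in epos G ->
    value e' w = value e' (\sum_j t j *~ value (tnth a j) w).
  move=> e'T e'F e'P; have : e' \in a.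
    by rewrite -[_ \in a]/(e' \in tval a) aE mem_pos_edges inE e'F e'T.
  case/tnthP=> i ->; rewrite value_sum (bigD1 i) //= tree_proj_dual eqxx mul1r.
  rewrite big1 ?addr0 // => j ji.
  by rewrite tree_proj_dual eq_sym (negPf ji) mul0r.
case: (boolP (e \in epos G)) => eP; first by rewrite -pos // subrr.
have Ve : value (einv e) w = value (einv e) (\sum_j t j *~ value (tnth a j) w).
  apply: pos; rewrite ?einv_in_epos ?Tinv //.
  by apply: contra eF => /Finv; rewrite einvK.
by move: Ve; rewrite !valueN => /oppr_inj ->; rewrite subrr.
Qed.

End TreeBasis.


(** * Comparison of an arbitrary basis with the tree bases *)

Section Basis.
Variables (k : nat) (F : {set edge G}) (u : k.-tuple (cochain G)).
Hypotheses (Finv : subgraph F) (uB : is_zbasis (coboundaries_rel F) u).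

Lemma zbasis_rel i : coboundaries_rel F (tnth u i).
Proof. by rewrite -uB.1; apply: sub_generated; exact: mem_tnth. Qed.

Lemma zbasis_expansion w : coboundaries_rel F w ->
  exists c : 'I_k -> int, w = \sum_i tnth u i *~ c i.
Proof. by rewrite -uB.1; exact: generated_tuple. Qed.

(* Both the u_i and the projections of the dual edges are bases of
   coboundaries_rel F, so that their cardinals agree. *)
Lemma size_pos_edges_tree T : spanning_tree T -> F \subset T ->
  size (pos_edges (T :\: F)) = k.
Proof.
move=> Ttree FT; set m := size _.
pose a : m.-tuple (edge G) := in_tuple (pos_edges (T :\: F)).
pose t j := tree_proj T (estar (tnth a j)).
have aE : a = pos_edges (T :\: F) :> seq _ by [].
have /choice[c tc] j : exists c : 'I_k -> int, t j = \sum_i tnth u i *~ c i.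
  exact/zbasis_expansion/(tree_proj_rel Ttree FT Finv aE).
(* [P] holds the coordinates of [u] in [t], and [Q] those of [t] in [u]; each of the two products
   being an identity bounds one size by the other. *)
pose P := \matrix_(i < k, j < m) value (tnth a j) (tnth u i).
pose Q := \matrix_(j < m, i < k) c j i.
apply/eqP; rewrite eqn_leq; apply/andP; split.
  apply: (@mulmx1_min _ _ _ Q P); apply/matrixP => j l; rewrite !mxE.
  rewrite eq_sym -(tree_proj_dual Ttree aE) -/(t j) tc value_sum.
  by apply: eq_bigr => i _; rewrite !mxE mulrC.
apply: (@mulmx1_min _ _ _ P Q); apply/matrixP => i l; rewrite !mxE.
apply/subr0_eq; move: l; apply: uB.2.
under eq_bigr do rewrite mulrzBr.
rewrite sumrB [X in _ - X](bigD1 i) //= eqxx mulr1z.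
rewrite [X in _ - (_ + X)]big1; last first.
  by move=> l li; rewrite eq_sym (negPf li) mulr0z.
rewrite addr0; apply/eqP; rewrite subr_eq0; apply/eqP.
rewrite [RHS](tree_proj_expansion Ttree FT Finv aE (zbasis_rel i)).
under [RHS]eq_bigr do rewrite -/(t _) tc mulrz_suml.
rewrite exchange_big; apply: eq_bigr => l _; rewrite mulrz_sumr.
by apply: eq_bigr => j _; rewrite !mxE -mulrzA mulrC.
Qed.

(** By duality, evaluation at the j-th edge of [a] reads off the j-th coordinate in the tree basis.
    This gives the coordinate matrix and its uniqueness, hence the value of [xget]. *)
Lemma det_bases_tree T : spanning_tree T -> F \subset T ->
  det_bases u (tree_basis k T F) =
    \det (\matrix_(i, j)
      nth 0 [seq value e (tnth u i) | e <- pos_edges (T :\: F)] j).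
Proof.
move=> Ttree FT; have sz := size_pos_edges_tree Ttree FT.
have /eqP szb := sz; pose a := Tuple szb.
have aE : a = pos_edges (T :\: F) :> seq _ by [].
have bE j : tnth (tree_basis k T F) j = tree_proj T (estar (tnth a j)).
  have -> : tree_basis k T F = map_tuple (fun e => tree_proj T (estar e)) a.
    by apply: val_inj; rewrite /= to_tupleK // size_map.
  by rewrite tnth_map.
set A := \matrix_(i, j) _.
have AE i j : A i j = value (tnth a j) (tnth u i).
  rewrite mxE (nth_map (tnth a j)) ?sz //; congr value.
  exact/esym/(tnth_nth _ a).
congr (\det _); apply: classical_sets.xget_unique => [i|B BA].
  rewrite [LHS](tree_proj_expansion Ttree FT Finv aE (zbasis_rel i)).
  by apply: eq_bigr => j _; rewrite bE AE.
apply/matrixP => i j; rewrite AE (BA i) value_sum (bigD1 j) //=.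
rewrite bE (tree_proj_dual Ttree aE) eqxx mul1r big1 ?addr0 // => l lj.
by rewrite bE (tree_proj_dual Ttree aE) eq_sym (negPf lj) mul0r.
Qed.

End Basis.

(** * A nonzero minor comes from a spanning tree *)

Section NonzeroDeterminant.
Variables (k : nat) (F : {set edge G}) (u : k.-tuple (cochain G)).
Variables (a : k.-tuple (edge G)).
Hypotheses (Gc : graph_connected G) (Finv : subgraph F) (Fac : acyclic F).
Hypotheses (uB : is_zbasis (coboundaries_rel F) u).
Hypotheses (aP : forall j, tnth a j \in epos G) (aU : uniq a).

Let M := \matrix_(i < k, j < k) value (tnth a j) (tnth u i).
Hypothesis M0 : \det M != 0.

Definition edge_span : {set edge G} :=
  [set e | [|| e \in F, e \in a | einv e \in a]].

Lemma edge_span_subgraph : subgraph edge_span.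
Proof.
move=> e; rewrite !inE einvK => /or3P[/Finv ->//|->|->]; by rewrite ?orbT.
Qed.

Lemma det_neq0_notin j : tnth a j \notin F.
Proof.
apply: contra_neqN M0 => ajF; apply: (@det0_col _ _ _ (fun l => (l == j)%:R) j).
  by rewrite eqxx.
move=> i; rewrite (bigD1 j) //= mxE.
have /(coboundaries_relP _ Finv)[_ ->//] := zbasis_rel uB i.
by rewrite mul0r add0r big1 // => l /negPf ->; rewrite mulr0.
Qed.

Lemma det_neq0_acyclic : acyclic edge_span.
Proof.
move=> c cT; move/eqP: M0; apply.
have [c0 cS _ cU] := cT.
have [e ec eF] : exists2 e, e \in c & e \notin F.
  apply/allPn/negP => /allP cF.
  by apply: (Fac (c := c)); case: cT => _ _ cc _; split.
have cuniq : uniq c by exact: map_uniq cU.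
(* [m j] counts with sign the passages of the cycle through the j-th edge of [a]. It is nonzero for
   some [j]: the edge [e] of the cycle outside [F] is, up to inversion, in [a], and a cycle never
   uses both an edge and its inverse. *)
pose m j := \sum_(e <- c) value e (estar (tnth a j)).
have mE j : m j = (tnth a j \in c)%:R - (einv (tnth a j) \in c)%:R.
  rewrite /m; under eq_bigr do rewrite value_estar.
  rewrite sumrB; congr (_ - _); rewrite -natr_sum -count_uniq_mem //.
    by congr (_%:R); rewrite -sum1_count [RHS]big_mkcond.
  by congr (_%:R); rewrite -sum1_count [RHS]big_mkcond.
have [j mj] : exists j, m j != 0.
  have : (e \in a) || (einv e \in a).
    by have := cS _ ec; rewrite inE (negPf eF).
  case/orP=> /tnthP[j E]; exists j; rewrite mE -E.
    by rewrite ec (negPf (cycle_einv cT ec)).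
  by rewrite einvK ec (negPf (cycle_einv cT ec)).
apply: (det0_col mj) => i.
have /(coboundaries_relP _ Finv)[iB iF] := zbasis_rel uB i.
(* The combination of columns with weights [m] equals the sum of [u_i] along the cycle, compared
   edge by edge: edges in [F] give 0 on both sides, the others are handled by [main]. *)
rewrite -[RHS](cycle_sum0 cT iB).
under eq_bigr do rewrite mxE mulr_sumr.
rewrite exchange_big; apply: eq_big_seq => e' /cS.
rewrite inE; case: (boolP (e' \in F)) => [e'F _|e'F /=].
  rewrite iF // big1 // => l _; rewrite value_estar.
  case: eqVneq => [E|_]; first by rewrite -E iF ?mul0r.
  case: eqVneq => [E|_]; last by rewrite subrr mulr0.
  by rewrite -[tnth a l](@einvK G) -E iF ?mul0r // Finv.
have main l s :
    \sum_j value (tnth a j) (tnth u s) * value (tnth a l) (estar (tnth a j))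
    = value (tnth a l) (tnth u s).
  rewrite (bigD1 l) //= value_estar_pos // eqxx mulr1 big1 ?addr0 // => p pl.
  rewrite value_estar_pos // (inj_eq (elimT (tuple_uniqP a) aU)) eq_sym.
  by rewrite (negPf pl) mulr0.
case/orP=> /tnthP[l E]; first by rewrite E main.
rewrite -[e'](@einvK G) E valueN -main -sumrN.
by apply: eq_bigr => s _; rewrite valueN mulrN.
Qed.

Lemma det_neq0_connected : nb_components edge_span = 1%N.
Proof.
have [x0] := connected_vertex Gc; have Tinv := edge_span_subgraph.
have symT := sym_connect_sym (adj_sym Tinv).
apply: (connect_nb_components1 x0) => // y z; move: M0; apply: contraNT => yz.
(* The indicator of the component of [y], which misses [z]. If the coefficients of [delta f] in [u]
   all vanished, [f] would be constant, [G] being connected; so they give a dependence between the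
   rows. *)
pose f x : int := (connect (adj edge_span) y x)%:R.
have f0 e : e \in edge_span -> value e (delta f) = 0.
  move=> /adj_edge/connect1 H; rewrite value_delta /f.
  by rewrite (same_connect_r symT H) subrr.
have fB : coboundaries_rel F (delta f).
  apply/coboundaries_relP => //; split=> [|e eF]; first by exists f.
  by apply: f0; rewrite inE eF.
have [c cE] := zbasis_expansion uB fB.
case: (boolP [exists i, c i != 0]) => [/existsP[i ci]|/existsPn c0].
  apply/eqP/(det0_row ci) => j.
  rewrite -[RHS](f0 (tnth a j)) ?inE ?mem_tnth ?orbT // cE value_sum.
  by apply: eq_bigr => l _; rewrite mxE mulrC.
have : delta f = 0.
  rewrite cE big1 // => i _.
  by have := c0 i; rewrite negbK => /eqP ->; rewrite mulr0z.
move=> f00; have closedf : closed (adj [set: edge G]) [pred x | f x == f y].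
  move=> x x' /exists_inP[e _ /andP[/eqP <- /eqP <-]]; rewrite !inE.
  have := value_delta f e; rewrite f00 (raddf0 (value e)) => /esym/subr0_eq E.
  by rewrite -E.
have Ginv : @subgraph G [set: edge G] by move=> e; rewrite !inE.
have := closed_connect closedf (nb_components1_connect y z Ginv Gc).
by rewrite !inE eqxx /f connect0 (negPf yz).
Qed.

End NonzeroDeterminant.

End Cochains.

(** * From subsets of edges to spanning trees *)

Theorem proposition3p3 (G : graph) (k : nat) (F : {set edge G})
    (u : k.-tuple (cochain G)) :
  graph_connected G ->
  forest k F ->
  is_zbasis (coboundaries_rel F) u ->
  wedge u =
    \sum_(T : {set edge G} | `[< spanning_tree T /\ F \subset T >])
      wedge (estar_tuple k (T :\: F)) *~ det_bases u (tree_basis k T F).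
Proof.
move=> Gc [Finv Fac _] uB.
(* The value 0 off [epos G] gives a zero column to each [A] containing a nonpositive edge. *)
pose c (i : 'I_k) e := if e \in epos G then value e (tnth u i) else 0.
have uE : u = [tuple \sum_e estar e *~ c i e | i < k].
  by apply: eq_from_tnth => i; rewrite tnth_mktuple; exact: estar_expansion.
pose r (A : {set edge G}) := sort (@ele G) (enum A).
have rE A : perm_eq (r A) (enum A) by rewrite perm_sort.
rewrite [in LHS]uE (wedge_expand _ _ rE).
pose h (T : {set edge G}) := (T :\: F) :&: epos G.
pose f A := wedge (to_tuple k [seq estar e | e <- r A]) *~
  \det (\matrix_(i < k, j < k) nth 0 [seq c i x | x <- r A] j).
pose D := [pred T : {set edge G} | `[< spanning_tree T /\ F \subset T >]].
rewrite -/(f _) [RHS](_ : _ = \sum_(T in D) f (h T)); last first.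
  apply: eq_bigr => T /asboolP[Ttree FT].
  rewrite (det_bases_tree Finv uB Ttree FT); congr (_ *~ \det _).
  apply/matrixP => i j; rewrite !mxE; congr (nth _ _ _).
  by apply/eq_in_map => e; rewrite mem_pos_edges /c => /andP[_ ->].
(* A tree containing [F] is recovered from its positive edges outside [F], being stable under
   inversion. The sum over trees thus becomes a sum over the image of [h]. *)
have hI : {in D &, injective h}.
  move=> T T' /asboolP[[Tinv _ _] FT] /asboolP[[T'inv _ _] FT'] TT'.
  have pos e : e \in epos G -> (e \in T) = (e \in T').
    move=> eP; have := congr1 (fun A : {set edge G} => e \in A) TT'.
    rewrite !inE eP !andbT; case: (boolP (e \in F)) => //= eF _.
    by rewrite (subsetP FT) ?(subsetP FT').
  apply/setP => e; case: (boolP (e \in epos G)) => [/pos //|eP].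
  have inv S : subgraph S -> (e \in S) = (einv e \in S).
    by move=> Sinv; apply/idP/idP => /Sinv; rewrite ?einvK.
  by rewrite inv // [RHS]inv // pos // einv_in_epos.
rewrite -(big_imset f hI) /= [LHS]big_mkcond [RHS]big_mkcond.
apply: eq_bigr => A _.
case: imsetP => [[T /asboolP[Ttree FT] ->]|AD]; last first.
  case: eqP => // Ak; rewrite /f; set M := \matrix_(_, _) _.
  suff -> : \det M = 0 by rewrite mulr0z.
  have rk : size (r A) == k by rewrite (perm_size (rE A)) -cardE Ak.
  pose a := Tuple rk.
  have aA e : (e \in a) = (e \in A) by rewrite (perm_mem (rE A)) mem_enum.
  have aU : uniq a by rewrite (perm_uniq (rE A)) enum_uniq.
  have ME i j : M i j = c i (tnth a j).
    rewrite mxE (nth_map (tnth a j)) ?(eqP rk) //; congr (c _ _).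
    exact/esym/(tnth_nth _ a).
  (* If the minor of [A] were nonzero, [edge_span F a] would be a tree containing [F] with image [A]
     under [h]. *)
  apply/eqP/contraT => M0; case: AD.
  have aP j : tnth a j \in epos G.
    apply: contra_neqT M0 => ajP.
    apply: (@det0_col _ _ _ (fun l => (l == j)%:R) j).
      by rewrite eqxx.
    move=> i; rewrite big1 // => l _; rewrite ME /c.
    by case: eqVneq => [->|_]; rewrite ?(negPf ajP) ?mul0r ?mulr0.
  have M0' : \det (\matrix_(i < k, j < k) value (tnth a j) (tnth u i)) != 0.
    suff <- : M = \matrix_(i < k, j < k) value (tnth a j) (tnth u i) by [].
    by apply/matrixP => i j; rewrite ME /c aP mxE.
  exists (edge_span F a).
    apply/asboolP; split; last by apply/subsetP => e; rewrite inE => ->.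
    split; first exact: edge_span_subgraph.
      exact: (det_neq0_acyclic Finv Fac uB aP aU M0').
    exact: (det_neq0_connected Gc Finv uB M0').
  apply/setP => e; rewrite !inE aA.
  apply/idP/idP => [|/andP[/andP[/negPf -> /=] /orP[->//|]]].
    rewrite -aA => /tnthP[j ->].
    by rewrite mem_tnth orbT aP (det_neq0_notin Finv uB M0').
  by move=> /tnthP[j E]; have := aP j; rewrite -E einv_in_epos => /negPf ->.
(* On the image of [h] the cardinality condition is automatic, by equality of the ranks. *)
case: eqP => // /eqP/negP; case; apply/eqP.
rewrite -(size_pos_edges_tree Finv uB Ttree FT) size_sort -cardE.
by [].
Qed.
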